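(* Let $G$ be a pants-like $\mathrm{COL}_2$ group and $\mathcal{C}=\{\mathcal{L}_1,\mathcal{L}_2\}$ a pants-like collection for $G$. Suppose that $\{x_n\}_{n=1}^\infty$ is a sequence in $S^1$ converging to $x\in S^1$ and $\{g_n\}_{n=1}^\infty$ is a sequence of distinct elements of $G$ such that $\{g_n(x_n)\}_{n=1}^\infty$ converges to $x'\in S^1$. Then at least one of the following holds: (1) there is a subsequence $\{g_{n_k}\}_{k=1}^\infty$ such that $g_{n_k}(x)=x'$ for all $k\in\mathbb{N}$; (2) there are a subsequence $\{g_{n_k}\}_{k=1}^\infty$ and a quasi-rainbow $\{I_k\}_{k=1}^\infty$ at $x'$ in $\mathcal{L}_i$, for some $i\in\{1,2\}$, such that $\{(g_{n_k},I_k)\}_{k=1}^\infty$ is a pre-approximation sequence at $x'$; (3) there are a subsequence $\{g_{n_k}\}_{k=1}^\infty$ and a quasi-rainbow $\{I_k\}_{k=1}^\infty$ at $x$ in $\mathcal{L}_i$, for some $i\in\{1,2\}$, such that $\{(g_{n_k}^{-1},I_k)\}_{k=1}^\infty$ is a pre-approximation sequence at $x$.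
   Context: $S^1$ is the unit circle, oriented counterclockwise. For distinct $u,v\in S^1$, $(u,v)_{S^1}$ is the set of $p$ such that $(u,p,v)$ is counterclockwise ordered (a nondegenerate open interval); the dual of $I=(u,v)_{S^1}$ is $I^*=(v,u)_{S^1}$; $\{I,I^*\}$ lies on $J$ if $I\subseteq J$ or $I^*\subseteq J$. A lamination system is a nonempty family $\mathcal{L}$ of nondegenerate open intervals such that: (1) $I\in\mathcal{L}\Rightarrow I^*\in\mathcal{L}$; (2) for all $I,J\in\mathcal{L}$, $\{I,I^*\}$ lies on $J$ or on $J^*$; (3) if $I_n\in\mathcal{L}$, $I_n\subseteq I_{n+1}$ for all $n$, and $\bigcup_n I_n$ is a nondegenerate open interval, then $\bigcup_n I_n\in\mathcal{L}$. A leaf is $\ell(I)=\{I,I^*\}$ with $I\in\mathcal{L}$. A gap is a subset $\mathscr{G}\subseteq\mathcal{L}$ of pairwise disjoint intervals such that for each $I\in\mathcal{L}$ there is $J\in\mathscr{G}$ on which $\ell(I)$ lies; $v(\mathscr{G})=S^1\setminus\bigcup_{I\in\mathscr{G}}I$. $\mathcal{L}$ is very full if $v(\mathscr{G})$ is finite for every gap. $E(\mathcal{L})=\bigcup_{I\in\mathcal{L}}v(\ell(I))$. For $G<\mathrm{Homeo}^+(S^1)$, $\mathcal{L}$ is $G$-invariant if $g(I)\in\mathcal{L}$ for all $g\in G$, $I\in\mathcal{L}$. Two lamination systems are transverse if disjoint as sets. A nontrivial element of $\mathrm{Homeo}^+(S^1)$ is parabolic if it has exactly one fixed point; a cusp point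 of $G$ is a point fixed by some parabolic element of $G$. A collection $\{\mathcal{L}_\alpha\}$ of $G$-invariant very full lamination systems is pants-like if its members are pairwise transverse and, for $\alpha\ne\beta$, every point of $E(\mathcal{L}_\alpha)\cap E(\mathcal{L}_\beta)$ is a cusp point of $G$. $G$ is pants-like $\mathrm{COL}_n$ if it admits a pants-like collection with $n$ elements. A quasi-rainbow at $p\in S^1$ in $\mathcal{L}$ is a sequence $\{I_n\}$ in $\mathcal{L}$ with $I_{n+1}\subseteq I_n$ for all $n$ and $\bigcap_n\overline{I_n}=\{p\}$. Given a $G$-invariant lamination system $\mathcal{L}$ and a quasi-rainbow $\{I_n\}$ at $p$ in $\mathcal{L}$, a sequence $\{(h_n,I_n)\}$ in $G\times\mathcal{L}$ is a pre-approximation sequence at $p$ if there is a point $z\in S^1$ such that $h_n(z)\in I_n$ for all $n\in\mathbb{N}$. *)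

(* Defs.v *)
From HB Require Import structures.
From mathcomp Require Import all_boot all_order all_algebra.
From mathcomp Require Import all_classical all_reals all_analysis.
From mathcomp Require Import ring lra.
Import Order.TTheory GRing.Theory Num.Theory.
Import numFieldNormedType.Exports.

Set Implicit Arguments.
Unset Strict Implicit.
Unset Printing Implicit Defensive.

Local Open Scope classical_set_scope.
Local Open Scope ring_scope.

Definition unit_circle (R : realType) : set (R * R)%type :=
  [set p | p.1 ^+ 2 + p.2 ^+ 2 = 1].

(* [set_type] carries the subspace topology. *)
Notation S1 R := (set_type (@unit_circle R)).

Section CircularOrder.
Variable R : realType.
Implicit Types (u p v : S1 R) (a b c t : R).

(* (u, p, v) is counterclockwise ordered: the triangle u p v is positively
   oriented. The description by angles is [ccwP] below. *)
Definition ccw u p v : Prop :=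
  0 < ((val p).1 - (val u).1) * ((val v).2 - (val u).2)
      - ((val p).2 - (val u).2) * ((val v).1 - (val u).1).

Lemma S1E u : (val u).1 ^+ 2 + (val u).2 ^+ 2 = 1.
Proof. by case: u => [q Hq] /=; have := set_mem Hq. Qed.

Lemma det_angle a b c :
  (cos b - cos a) * (sin c - sin a) - (sin b - sin a) * (cos c - cos a)
  = 4 * sin ((b - a) / 2) * sin ((c - b) / 2) * sin ((c - a) / 2).
Proof.
have sin2 t : sin (t + t) = 2 * sin t * cos t by rewrite sinD; ring.
have cos2 t : cos (t + t) = 1 - 2 * sin t ^+ 2.
  by rewrite cosD -[X in X - _ = _]expr2 cos2sin2; ring.
have [r er] : exists r, b - a = r + r by exists ((b - a) / 2); field.
have [s es] : exists s, c - b = s + s by exists ((c - b) / 2); field.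
have ers : c - a = (r + r) + (s + s) by rewrite -er -es; ring.
transitivity (sin (b - a) + sin (c - b) - sin (c - a)).
  by rewrite !sinB; ring.
have -> : (c - a) / 2 = r + s by rewrite ers; field.
have -> : (b - a) / 2 = r by rewrite er; field.
have -> : (c - b) / 2 = s by rewrite es; field.
by rewrite ers er es [sin (r + r + _)]sinD !cos2 !sin2 [sin (r + s)]sinD; ring.
Qed.

Lemma circle_angle (x y : R) : x ^+ 2 + y ^+ 2 = 1 ->
  exists2 t, 0 <= t < 2 * pi & x = cos t /\ y = sin t.
Proof.
move=> xy.
have pi0 := pi_gt0 R.
have x1 : -1 <= x <= 1 by apply/andP; split; nra.
have ex : cos (acos x) = x by apply: acosK; rewrite in_itv.
have y2 : sin (acos x) = `|y|.
  by rewrite sin_acos // -sqrtr_sqr; congr Num.sqrt; rewrite -xy; ring.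
have a0 := acos_ge0 x1; have ap := acos_lepi x1.
have [y0|y0] := leP 0 y.
  exists (acos x); first by apply/andP; split => //; lra.
  by rewrite ex y2 ger0_norm.
exists (2 * pi - acos x).
  apply/andP; split; first by lra.
  have : acos x != 0; last by move=> h; rewrite ltrBlDr ltrDl lt_neqAle eq_sym h.
  by apply/eqP => h; move: y2; rewrite h sin0 ltr0_norm //; lra.
have -> : 2 * pi - acos x = - acos x + pi *+ 2 by rewrite mulr_natl addrC.
by rewrite cosD2pi sinD2pi cosN sinN ex y2 ltr0_norm // opprK.
Qed.

Lemma S1_angle a p : exists2 t, a <= t < a + 2 * pi & val p = (cos t, sin t).
Proof.
have := S1E p; case: (val p) => x y /= xy.
have [|t /andP[t0 t1] [ec es]] :=
    @circle_angle (x * cos a + y * sin a) (y * cos a - x * sin a).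
  transitivity ((x ^+ 2 + y ^+ 2) * (cos a ^+ 2 + sin a ^+ 2)); first by ring.
  by rewrite xy cos2Dsin2 mulr1.
exists (a + t); first by apply/andP; split; lra.
rewrite cosD sinD -ec -es.
by congr pair; rewrite -[LHS]mulr1 -(cos2Dsin2 a); ring.
Qed.

Lemma ccw_angle a b c u p v : a <= b < a + 2 * pi -> a <= c < a + 2 * pi ->
  val u = (cos a, sin a) -> val p = (cos b, sin b) -> val v = (cos c, sin c) ->
  ccw u p v <-> a < b < c.
Proof.
have pi0 := pi_gt0 R.
move=> /andP[b0 b1] /andP[c0 c1] eu ep ev.
rewrite /ccw eu ep ev /= det_angle; split; last first.
  move=> /andP[ab bc].
  by rewrite !mulr_gt0 //; apply: sin_gt0_pi; rewrite ?in_itv /=; lra.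
move=> h.
have sne t : a <= t -> t < a + 2 * pi -> sin ((t - a) / 2) != 0 ->
    a < t /\ 0 < sin ((t - a) / 2).
  move=> t0 t1 s0; have lt : a < t.
    rewrite lt_neqAle t0 andbT; apply/eqP => e.
    by move: s0; rewrite e subrr mul0r sin0 eqxx.
  by split=> //; apply: sin_gt0_pi; rewrite ?in_itv /=; lra.
have [||//|lab sab] := sne b => //.
  by apply/eqP => e; move: h; rewrite e mulr0 !mul0r ltxx.
have [||//|lac sac] := sne c => //.
  by apply/eqP => e; move: h; rewrite e mulr0 ltxx.
rewrite lab ltNge; apply/negP => cb.
have : 0 <= sin ((b - c) / 2) by apply: sin_ge0_pi; rewrite ?in_itv /=; lra.
have -> : (b - c) / 2 = - ((c - b) / 2) by field.
rewrite sinN oppr_ge0 => s0.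
move: h; rewrite ltNge => /negP; apply.
by rewrite pmulr_lle0 // pmulr_rle0 // mulr_gt0.
Qed.

Lemma ccwP u p v : ccw u p v <->
  exists a b c, [/\ a < b, b < c & c < a + 2 * pi] /\
    [/\ val u = (cos a, sin a), val p = (cos b, sin b)
      & val v = (cos c, sin c)].
Proof.
have pi0 := pi_gt0 R.
split; last first.
  move=> [a [b [c [[ab bc ca] [eu ep ev]]]]].
  by apply/(ccw_angle _ _ eu ep ev); apply/andP; split; lra.
have [a _ eu] := S1_angle 0 u.
have [b bi ep] := S1_angle a p.
have [c ci ev] := S1_angle a v.
move=> /(ccw_angle bi ci eu ep ev) /andP[ab bc].
by exists a, b, c; split; split=> //; case/andP: ci.
Qed.

Lemma ccw_cycle u p v : ccw u p v -> ccw p v u.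
Proof. by rewrite /ccw; lra. Qed.

Lemma ccw_trans u p q v : ccw u p q -> ccw u q v -> ccw u p v.
Proof.
have [a _ eu] := S1_angle 0 u.
have [b bi ep] := S1_angle a p.
have [c ci eq] := S1_angle a q.
have [d di ev] := S1_angle a v.
move=> /(ccw_angle bi ci eu ep eq) /andP[ab bc].
move=> /(ccw_angle ci di eu eq ev) /andP[ac cd].
by apply/(ccw_angle bi di eu ep ev); rewrite ab (lt_trans bc).
Qed.

Lemma ccw_irr u p v : ccw u p v -> [/\ u <> p, p <> v & u <> v].
Proof. by rewrite /ccw => h; split=> e; subst; lra. Qed.

Lemma ccw_total u p v : u <> p -> p <> v -> u <> v -> ccw u p v \/ ccw u v p.
Proof.
have [a _ eu] := S1_angle 0 u.
have [b bi ep] := S1_angle a p.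
have [c ci ev] := S1_angle a v.
move=> up pv uv.
have ab : a < b.
  case/andP: (bi) => b0 _; rewrite lt_neqAle b0 andbT; apply/eqP => e.
  by apply: up; apply: val_inj; rewrite /= eu ep e.
have ac : a < c.
  case/andP: (ci) => c0 _; rewrite lt_neqAle c0 andbT; apply/eqP => e.
  by apply: uv; apply: val_inj; rewrite /= eu ev e.
have [bc|cb|e] := ltgtP b c.
- by left; apply/(ccw_angle bi ci eu ep ev); rewrite ab.
- by right; apply/(ccw_angle ci bi eu ev ep); rewrite ac.
- by case: pv; apply: val_inj; rewrite /= ep ev e.
Qed.

Lemma ccw_dense u v : u <> v -> exists p, ccw u p v.
Proof.
have [a _ eu] := S1_angle 0 u.
have [c /[dup] ci /andP[c0 c1] ev] := S1_angle a v.
move=> uv.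
have ac : a < c.
  rewrite lt_neqAle c0 andbT; apply/eqP => e.
  by apply: uv; apply: val_inj; rewrite /= eu ev e.
have hp : (cos ((a + c) / 2), sin ((a + c) / 2)) \in @unit_circle R.
  by apply/mem_set; rewrite /unit_circle /= cos2Dsin2.
exists (exist (fun q => q \in @unit_circle R) _ hp).
apply/(@ccw_angle a ((a + c) / 2) c) => //; by apply/andP; split; lra.
Qed.

End CircularOrder.

(* Orientation-preserving homeomorphisms of the circle; the inverse is a field
   only so that inversion needs no choice, it is determined by [homeo_fun]. *)
Record homeoP (R : realType) := HomeoP {
  homeo_fun :> S1 R -> S1 R ;
  homeo_inv : S1 R -> S1 R ;
  homeo_funK : cancel homeo_fun homeo_inv ;
  homeo_invK : cancel homeo_inv homeo_fun ;
  homeo_fun_continuous : continuous homeo_fun ;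
  homeo_inv_continuous : continuous homeo_inv ;
  homeo_ccw : forall u p v,
    ccw (homeo_fun u) (homeo_fun p) (homeo_fun v) <-> ccw u p v
}.

HB.instance Definition _ (R : realType) := gen_eqMixin (homeoP R).
HB.instance Definition _ (R : realType) := gen_choiceMixin (homeoP R).

Section HomeoGroup.
Variable R : realType.
Implicit Types f g h : homeoP R.

Lemma homeo_eq f g : (forall x, f x = g x) -> f = g.
Proof.
case: f g => [f f' fK f'K fc f'c fo] [g g' gK g'K gc g'c go] /= /funext efg.
subst g.
have e : f' = g' by apply/funext => x; rewrite -{1}(g'K x) fK.
by subst g'; congr HomeoP; exact: Prop_irrelevance.
Qed.

Definition homeo_id : homeoP R.
Proof. by apply: (@HomeoP R id id) => // x; exact: cvg_id. Defined.

Definition homeo_comp f g : homeoP R.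
Proof.
apply: (@HomeoP R (f \o g) (homeo_inv g \o homeo_inv f)).
- by move=> x /=; rewrite !homeo_funK.
- by move=> x /=; rewrite !homeo_invK.
- move=> x; apply: continuous_comp; exact: homeo_fun_continuous.
- move=> x; apply: continuous_comp; exact: homeo_inv_continuous.
- by move=> u p v /=; rewrite !homeo_ccw.
Defined.

Definition homeo_opp f : homeoP R.
Proof.
apply: (@HomeoP R (homeo_inv f) f).
- exact: homeo_invK.
- exact: homeo_funK.
- exact: homeo_inv_continuous.
- exact: homeo_fun_continuous.
- by move=> u p v; rewrite -(homeo_ccw f) !homeo_invK.
Defined.

Fact homeo_compA : associative homeo_comp.
Proof. by move=> f g h; exact: homeo_eq. Qed.
Fact homeo_comp1h : left_id homeo_id homeo_comp.
Proof. by move=> f; exact: homeo_eq. Qed.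
Fact homeo_comph1 : right_id homeo_id homeo_comp.
Proof. by move=> f; exact: homeo_eq. Qed.
Fact homeo_compVh : left_inverse homeo_id homeo_opp homeo_comp.
Proof. by move=> f; apply: homeo_eq => x /=; rewrite homeo_funK. Qed.
Fact homeo_comphV : right_inverse homeo_id homeo_opp homeo_comp.
Proof. by move=> f; apply: homeo_eq => x /=; rewrite homeo_invK. Qed.

HB.instance Definition _ := isGroup.Build (homeoP R)
  homeo_compA homeo_comp1h homeo_comph1 homeo_compVh homeo_comphV.

Lemma homeo1E x : (1%g : homeoP R) x = x. Proof. by []. Qed.
Lemma homeoME f g x : (f * g)%g x = f (g x). Proof. by []. Qed.
Lemma homeoVE f x : (f^-1)%g x = homeo_inv f x. Proof. by []. Qed.

End HomeoGroup.

Section Laminations.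
Variable R : realType.
Implicit Types (u v p x : S1 R) (I J : set (S1 R)) (L : set (set (S1 R))).
Implicit Types (G : set (homeoP R)) (g : homeoP R).

Definition subgroup G : Prop :=
  G 1%g /\ (forall g h, G g -> G h -> G (g * h^-1)%g).

Definition arc u v : set (S1 R) := [set p | ccw u p v].

Definition nondegenerate_open_interval I : Prop :=
  exists u v, u <> v /\ I = arc u v.

(* The endpoints of a nondegenerate open interval are determined by the
   interval, so this is arc v u when I = arc u v, see [dual_arc]; it is empty
   when I is not a nondegenerate open interval. *)
Definition dual I : set (S1 R) :=
  [set q | exists u v, [/\ u <> v, I = arc u v & arc v u q]].

Lemma arc_inj u v u' v' : u <> v -> arc u v = arc u' v' -> u = u' /\ v = v'.
Proof.
move=> uv e.
have [p] := ccw_dense uv; have ep q : ccw u q v <-> ccw u' q v'.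
  by have /seteqP[h1 h2] := e; split; [exact: h1|exact: h2].
move=> h; have /ep h' := h.
have [up pv _] := ccw_irr h; have [u'p pv' _] := ccw_irr h'.
split; apply: contrapT => ne.
  have [k|k] := ccw_total ne u'p up.
    by have /ep/ccw_irr[] := ccw_trans k h.
  have /ep/ccw_irr[] // : ccw u' u v'.
  by apply: ccw_trans h'; exact: ccw_cycle (ccw_cycle k).
have hv := ccw_cycle (ccw_cycle h); have hv' := ccw_cycle (ccw_cycle h').
have [k|k] := ccw_total pv' (not_eq_sym ne) pv.
  have /ep/ccw_irr[] // : ccw u v' v.
  exact: ccw_cycle (ccw_trans hv (ccw_cycle (ccw_cycle k))).
have /ep/ccw_irr[] // : ccw u' v v'.
exact: ccw_cycle (ccw_trans hv' (ccw_cycle (ccw_cycle k))).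
Qed.

Lemma dual_arc u v : u <> v -> dual (arc u v) = arc v u.
Proof.
move=> uv; apply/seteqP; split=> [q [u' [v' [_ e]]]|q vqu]; last by exists u, v.
by have [<- <-] := arc_inj uv e.
Qed.

Definition lies_on I J : Prop := I `<=` J \/ dual I `<=` J.

Record lamination_system L : Prop := {
  lam_nonempty : L !=set0 ;
  lam_interval : forall I, L I -> nondegenerate_open_interval I ;
  lam_dual : forall I, L I -> L (dual I) ;
  lam_unlinked : forall I J, L I -> L J -> lies_on I J \/ lies_on I (dual J) ;
  lam_closed : forall I_ : nat -> set (S1 R),
    (forall n, L (I_ n)) -> (forall n, I_ n `<=` I_ n.+1) ->
    nondegenerate_open_interval (\bigcup_n I_ n) -> L (\bigcup_n I_ n)
}.

Definition leaf I : set (set (S1 R)) := [set I; dual I].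

Definition gap L (P : set (set (S1 R))) : Prop :=
  [/\ P `<=` L,
      (forall I J, P I -> P J -> I <> J -> I `&` J = set0)
    & (forall I, L I -> exists2 J, P J & lies_on I J)].

Definition vertices (P : set (set (S1 R))) : set (S1 R) :=
  ~` \bigcup_(I in P) I.

Definition very_full L : Prop :=
  forall P, gap L P -> finite_set (vertices P).

Definition endpoints L : set (S1 R) := \bigcup_(I in L) vertices (leaf I).

Definition invariant G L : Prop := forall g I, G g -> L I -> L (g @` I).

Definition transverse L1 L2 : Prop := L1 `&` L2 = set0.

Definition parabolic g : Prop :=
  g <> 1%g /\ exists p, forall q, g q = q <-> q = p.

Definition cusp_point G p : Prop :=
  exists g, [/\ G g, parabolic g & g p = p].

Definition pants_like G (A : Type) (L_ : A -> set (set (S1 R))) : Prop :=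
  [/\ (forall i, [/\ lamination_system (L_ i), invariant G (L_ i)
                   & very_full (L_ i)]),
      (forall i j, i <> j -> transverse (L_ i) (L_ j))
    & (forall i j, i <> j ->
         endpoints (L_ i) `&` endpoints (L_ j) `<=` cusp_point G)].

Definition pants_like_COL (n : nat) G : Prop :=
  subgroup G /\ exists L_ : 'I_n -> set (set (S1 R)), pants_like G L_.

Definition quasi_rainbow L p (I_ : nat -> set (S1 R)) : Prop :=
  [/\ (forall n, L (I_ n)), (forall n, I_ n.+1 `<=` I_ n)
    & \bigcap_n closure (I_ n) = [set p]].

Definition pre_approximation G L p (h_ : nat -> homeoP R)
    (I_ : nat -> set (S1 R)) : Prop :=
  [/\ quasi_rainbow L p I_, (forall n, G (h_ n))
    & exists z, forall n, I_ n (h_ n z)].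

End Laminations.

(* Main.v *)
(* At every point p some quasi-rainbow captures a subsequence of any given
   sequence that accumulates at p with terms different from p. If p is not an endpoint of some L_i, the
   members of L_i missing p and containing a given one form a chain; if none of
   these chains exhausts the circle minus p, their unions are members of L_i and
   form a gap which has p as a vertex, and p, not being an endpoint, cannot be
   isolated among the vertices, against very fullness. Otherwise p is fixed by a
   parabolic element, and the leaves ending at p shrink to p on both sides.
   Now capture g_n(x_n) by a quasi-rainbow I_k at x' and pull it back by g_n.
   Either some z lies in infinitely many of the pulled back arcs, giving (2), or
   these arcs, which contain x_n, shrink to x. Then g_n^-1(x') tends to x, so
   that either (1) holds or g_n^-1(x') is captured at x, giving (3). *)
Require Import Defs.
From mathcomp Require Import all_boot all_order all_algebra.
From mathcomp Require Import all_classical all_reals all_analysis.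
From mathcomp Require Import ring lra.
Import Order.TTheory GRing.Theory Num.Theory.
Import numFieldNormedType.Exports.

Set Implicit Arguments.
Unset Strict Implicit.
Unset Printing Implicit Defensive.

Local Open Scope classical_set_scope.
Local Open Scope ring_scope.

Local Notation arc := Defs.arc.

(** Take the minimum of the positive values of [f] along an enumeration of [A], with [b] for the
    empty list. Applied to angles, this isolates a point among finitely many vertices. *)
Lemma finite_set_gap (R : realType) (T : choiceType) (A : set T) (f : T -> R) (b : R) :
  0 < b -> finite_set A ->
  exists2 e : R, 0 < e <= b & forall x, A x -> 0 < f x -> e <= f x.
Proof.
move=> b0 /finite_seqP[s ->]; elim: s => [|x s [e /andP[e0 eb] IHs]].
  by exists b => //; rewrite b0 lexx.
have [fx0|fx0] := ltP 0 (f x); last first.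
  exists e => [|y /=]; first exact/andP.
  by rewrite inE => /orP[/eqP -> /lt_le_trans/(_ fx0)|/IHs //]; rewrite ltxx.
exists (Num.min e (f x)) => [|y /=]; first by rewrite lt_min e0 fx0 ge_min eb.
by rewrite inE ge_min => /orP[/eqP ->|/IHs h /h ->] //; rewrite lexx orbT.
Qed.

(** * Angular coordinates on the circle *)

Section Angle.
Context {R : realType}.
Implicit Types (a b t : R) (p q u v w : S1 R).

Definition circle_pt t : S1 R :=
  exist _ (cos t, sin t) (mem_set (cos2Dsin2 t : @unit_circle R (cos t, sin t))).

Lemma circle_pt_surj a p : exists2 t, a <= t < a + 2 * pi & p = circle_pt t.
Proof. by have [t ht e] := S1_angle a p; exists t => //; exact: val_inj. Qed.

Lemma continuous_circle_pt : continuous circle_pt.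
Proof.
apply: (@continuous_comp_initial (S1 R) R (R * R)%type val) => t.
apply: (@cvg_pair _ _ _ (nbhs t) (nbhs (cos t)) (nbhs (sin t)));
  [exact: continuous_cos|exact: continuous_sin].
Qed.

(* The angle from [p] counterclockwise to [q], in [0, 2 pi). *)
Definition angle p q : R :=
  let a := s2val (cid2 (circle_pt_surj 0 p)) in
  s2val (cid2 (circle_pt_surj a q)) - a.

Lemma angleE p : exists a, [/\ circle_pt a = p,
  forall q, q = circle_pt (a + angle p q) & forall q, 0 <= angle p q < 2 * pi].
Proof.
rewrite /angle; case: cid2 => a /= _ ep; exists a; split=> // q;
  case: cid2 => t /=; first by rewrite subrKC.
by move=> /andP[at1 ta] _; apply/andP; split; lra.
Qed.

Lemma angle_ge0 p q : 0 <= angle p q.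
Proof. by have [a [_ _ /(_ q)/andP[]]] := angleE p. Qed.

Lemma angle_lt2pi p q : angle p q < 2 * pi.
Proof. by have [a [_ _ /(_ q)/andP[]]] := angleE p. Qed.

Lemma angle_inj p : injective (angle p).
Proof. by have [a [_ h _]] := angleE p => q r e; rewrite (h q) (h r) e. Qed.

(** Once [u] comes first, the three angles, shifted by a lift of [p], lie within one turn starting
    at [u], so [ccw_angle] applies. *)
Lemma ccw_angle_lin p u v w : angle p u <= angle p v -> angle p u <= angle p w ->
  ccw u v w <-> angle p u < angle p v < angle p w.
Proof.
have [a [_ h b]] := angleE p; move=> uv uw.
have := b u; have := b v; have := b w => /andP[? ?] /andP[? ?] /andP[? ?].
have := @ccw_angle R (a + angle p u) (a + angle p v) (a + angle p w) u v w.
rewrite !ltrD2l; apply; try (by apply/andP; split; lra);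
  by [rewrite {1}(h u)|rewrite {1}(h v)|rewrite {1}(h w)].
Qed.

(** By cyclic invariance a point of least angle can be put first. Orientation questions thereby
    become linear arithmetic. *)
Lemma ccw_angleE p u v w : ccw u v w <->
  [\/ angle p u < angle p v < angle p w, angle p v < angle p w < angle p u |
      angle p w < angle p u < angle p v].
Proof.
have cyc x y z : ccw x y z <-> ccw y z x.
  by split; [exact: ccw_cycle|move=> h; do 2 apply: ccw_cycle].
have [uv|vu] := leP (angle p u) (angle p v);
  have [vw|wv] := leP (angle p v) (angle p w);
  have [uw|wu] := leP (angle p u) (angle p w);
  [rewrite (@ccw_angle_lin p)| |rewrite (@ccw_angle_lin p)|
   rewrite -cyc (@ccw_angle_lin p)|
   rewrite cyc (@ccw_angle_lin p)|rewrite cyc (@ccw_angle_lin p)| |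
   rewrite -cyc (@ccw_angle_lin p)]; try lra;
  by split=> [/andP[? ?]|[]/andP[? ?]]; try (by apply/andP; split; lra);
   try (by constructor; apply/andP; split; lra); lra.
Qed.

Lemma circle_pt_neq a b : a < b < a + 2 * pi -> circle_pt a <> circle_pt b.
Proof.
move=> /andP[ab ba] /(congr1 val) /= [ec es].
(* Equal points would give [cos (b - a) = 1], hence a zero of the sine at the half angle, which lies
   strictly between [0] and [pi]. *)
have : 0 < sin ((b - a) / 2) by apply: sin_gt0_pi; rewrite ?in_itv /=; lra.
suff : sin ((b - a) / 2) ^+ 2 = 0 by move/eqP; rewrite sqrf_eq0 => /eqP ->; lra.
have : cos ((b - a) / 2 + (b - a) / 2) = 1.
  have -> : (b - a) / 2 + (b - a) / 2 = b - a by field.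
  by rewrite cosB -ec -es -!expr2 cos2Dsin2.
by rewrite cosD -!expr2 cos2sin2; lra.
Qed.

Lemma angle_circle_pt p : exists a, forall t, 0 <= t < 2 * pi ->
  angle p (circle_pt (a + t)) = t /\ circle_pt a = p.
Proof.
have [a [ep h b]] := angleE p; exists a => t /andP[t0 t1]; split=> //.
have /esym := h (circle_pt (a + t)); have /andP[] := b (circle_pt (a + t)).
move: (angle _ _) => s s0 s1 e.
have [ts|ts|//] := ltgtP s t.
  by case: (@circle_pt_neq (a + s) (a + t)) => //; apply/andP; split; lra.
by case: (@circle_pt_neq (a + t) (a + s)) => //; apply/andP; split; lra.
Qed.

Lemma angle_surj p t : 0 <= t < 2 * pi -> exists q, angle p q = t.
Proof. by have [a h] := angle_circle_pt p => /h[? _]; exists (circle_pt (a + t)). Qed.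

Lemma ccw_asym u v w : ccw u v w -> ~ ccw w v u.
Proof.
move=> /(ccw_angleE u) h /(ccw_angleE u).
by move: h => [] /andP[? ?] [] /andP[? ?]; lra.
Qed.

Lemma angle0 p : angle p p = 0.
Proof.
have pi0 := pi_gt0 R.
have [a h] := angle_circle_pt p; have [|e ep] := h 0; first by apply/andP; lra.
by rewrite addr0 ep in e.
Qed.

Lemma angle_gt0 p q : q <> p -> 0 < angle p q.
Proof.
move=> qp; rewrite lt_neqAle angle_ge0 andbT; apply/eqP => e.
by apply: qp; apply: (@angle_inj p); rewrite angle0.
Qed.

Lemma ccw_base p u v : ccw p u v <-> 0 < angle p u < angle p v.
Proof. by rewrite (@ccw_angle_lin p) ?angle0 ?angle_ge0. Qed.

End Angle.

(** * Closures and duals of arcs *)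

Section ArcTopology.
Context {R : realType}.
Implicit Types (p q u v w : S1 R).

Lemma open_arc u v : open (arc u v).
Proof.
pose F (z : R * R) := (z.1 - (val u).1) * ((val v).2 - (val u).2)
  - (z.2 - (val u).2) * ((val v).1 - (val u).1).
exists (F @^-1` [set t | 0 < t]) => //.
apply: open_comp; last exact: open_gt.
move=> z _; rewrite /F; apply: cvgB; apply: cvgM; try exact: cvg_cst;
  apply: cvgB; try exact: cvg_cst; [exact: cvg_fst|exact: cvg_snd].
Qed.

Lemma closure_arc u v w : closure (arc u v) w -> ~ ccw v w u.
Proof.
move=> cw vwu; have [|q [uqv vqu]] := cw (arc v u).
  exact: (open_nbhs_nbhs (conj (open_arc v u) vwu)).
exact: (ccw_asym uqv).
Qed.

Lemma closure_arc_endpoints p q : p <> q ->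
  closure (arc p q) p /\ closure (arc q p) p.
Proof.
move=> pq; have pi0 := pi_gt0 R.
have q0 := angle_gt0 (not_eq_sym pq); have q1 := angle_lt2pi p q.
have [a h] := angle_circle_pt p.
have [|_ ea] := h 0; first by apply/andP; lra.
have near_p B : nbhs p B -> exists2 d : R, 0 < d & forall t, `|t| < d -> B (circle_pt (a + t)).
  rewrite -ea => /(@continuous_circle_pt R a)/nbhs_ballP[d /= d0 dB]; exists d => // t td.
  by apply: dB; rewrite /ball /= opprD addNKr normrN.
split=> B /near_p[d d0 dB].
  pose t := Num.min (d / 2) (angle p q / 2).
  have t0 : 0 < t by rewrite lt_min; apply/andP; split; lra.
  have td : t <= d / 2 by rewrite ge_min lexx.
  have tq : t <= angle p q / 2 by rewrite ge_min lexx orbT.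
  exists (circle_pt (a + t)); split; last by apply: dB; rewrite gtr0_norm; lra.
  by apply/ccw_base; have [|-> _] := h t; apply/andP; lra.
pose t := Num.min (d / 2) ((2 * pi - angle p q) / 2).
have t0 : 0 < t by rewrite lt_min; apply/andP; split; lra.
have td : t <= d / 2 by rewrite ge_min lexx.
have tq : t <= (2 * pi - angle p q) / 2 by rewrite ge_min lexx orbT.
exists (circle_pt (a + - t)); split; last by apply: dB; rewrite normrN gtr0_norm; lra.
apply: ccw_cycle; apply/ccw_base.
(* The offset [- t] is outside the range of [angle]; adding a full turn brings it back. *)
have -> : circle_pt (a - t) = circle_pt (a + (2 * pi - t)).
  have -> : a + (2 * pi - t) = a - t + pi *+ 2 by ring.
  by apply: val_inj; rewrite /= cosD2pi sinD2pi.
by have [|-> _] := h (2 * pi - t); apply/andP; lra.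
Qed.

(** Away from [u] and [v] every point lies on one of the two open arcs, and the endpoints are limits
    of the arc. *)
Lemma closure_arcP u v w : u <> v -> closure (arc u v) w <-> ~ ccw v w u.
Proof.
move=> uv; split=> [|nvwu]; first exact: closure_arc.
have [->|wu] := pselect (w = u); first by have [] := closure_arc_endpoints uv.
have [->|wv] := pselect (w = v).
  by have [] := closure_arc_endpoints (not_eq_sym uv).
apply: subset_closure.
by have [//|/ccw_cycle] := ccw_total (not_eq_sym wu) wv uv.
Qed.

(** The dual is the complement of the closure, and closure is monotone. *)
Lemma arc_sub_dual (I J : set (S1 R)) : nondegenerate_open_interval I ->
  nondegenerate_open_interval J -> I `<=` J -> dual J `<=` dual I.
Proof.
move=> [u [v [uv ->]]] [u' [v' [uv' ->]]] IJ q.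
rewrite !dual_arc // => v'qu'; apply: contrapT => /(closure_arcP _ uv)/(closureS IJ).
by move/closure_arc; apply.
Qed.

Lemma arc_angle p u v q : angle p u < angle p v ->
  arc u v q <-> angle p u < angle p q < angle p v.
Proof.
move=> uv; split=> [/(ccw_angleE p)|h]; last by apply/(ccw_angleE p); constructor.
by case=> /andP[? ?]; apply/andP; lra.
Qed.

End ArcTopology.

(** * Rainbows at a point that is not an endpoint *)

Definition rainbow {R : realType} (L : set (set (S1 R))) (p : S1 R)
    (I_ : nat -> set (S1 R)) : Prop :=
  quasi_rainbow L p I_ /\ forall n, I_ n p.

Section Rainbow.
Context {R : realType} (L : set (set (S1 R))) (p : S1 R).
Hypotheses (lamL : lamination_system L) (pE : ~ endpoints L p).
Implicit Types (I J : set (S1 R)).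

Definition missing I : Prop := L I /\ ~ I p.

(** A non-endpoint outside [I] is inside [dual I], so [I] does not cross the cut at [p] and becomes
    an interval of angles. *)
Lemma missing_arc I : missing I ->
  exists u v, 0 < angle p u < angle p v /\ I = arc u v.
Proof.
move=> [LI Ip]; have [u [v [uv eI]]] := lam_interval lamL LI.
exists u, v; split=> //; apply/ccw_base.
apply: contrapT => puv; apply: pE; exists I => // -[J [->|->]] //.
by rewrite eI dual_arc // => /ccw_cycle.
Qed.

Lemma missing_neq0 I : missing I -> I !=set0.
Proof.
move=> /missing_arc[u [v [/andP[_ uv] ->]]].
by apply: ccw_dense => e; rewrite e ltxx in uv.
Qed.

Lemma missing_dual I : L I -> I p -> missing (dual I).
Proof.
move=> LI Ip; split; first exact: lam_dual.
have [u [v [uv eI]]] := lam_interval lamL LI; move: Ip; rewrite eI dual_arc //.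
exact: ccw_asym.
Qed.

Lemma dual_missing I : missing I -> dual I p.
Proof.
move=> [LI Ip]; apply: contrapT => dIp; apply: pE; exists I => //.
by case=> J [->|->].
Qed.

(** Of the four positions of unlinked leaves, [dual I] inside [J] is excluded by [p] and [I] inside
    [dual J] by [q]; the other two are nestings. *)
Lemma missing_nested I J q : missing I -> missing J -> I q -> J q ->
  I `<=` J \/ J `<=` I.
Proof.
move=> mI mJ Iq Jq; have [LI Ip] := mI; have [LJ Jp] := mJ.
have [u [v [/andP[u0 uv] eI]]] := missing_arc mI.
have [u' [v' [/andP[u0' uv'] eJ]]] := missing_arc mJ.
have ne a b : angle p a < angle p b -> a <> b by move=> ab e; rewrite e ltxx in ab.
have [[|d]|[d|d]] := lam_unlinked lamL LI LJ; first by left.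
- by case: Jp; apply: d; exact: dual_missing.
- have := d _ Iq; rewrite eJ dual_arc; last exact: ne.
  by move: Jq; rewrite eJ => /ccw_asym.
- right; have := arc_sub_dual _ _ d; rewrite eI eJ !dual_arc;
    try exact: ne; try exact/not_eq_sym/ne.
  by apply; [exists v, u|exists v', u']; split=> //; exact/not_eq_sym/ne.
Qed.

(** A union over a chain, by [missing_nested]. Lamination systems are closed under unions of
    increasing sequences, so a cofinal sequence has to be extracted. *)
Definition mhull I : set (S1 R) :=
  \bigcup_(K in [set K | missing K /\ I `<=` K]) K.

Lemma mhull_interval I : missing I -> exists s t : R,
  [/\ 0 <= s, s < t, t <= 2 * pi, forall q, mhull I q <-> s < angle p q < t
  & exists K_ : nat -> set (S1 R), [/\ forall n, missing (K_ n),
      forall n, K_ n `<=` K_ n.+1 & mhull I = \bigcup_n K_ n]].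
Proof.
move=> mI; pose S := angle p @` mhull I.
pose s := inf S; pose t := sup S.
have IU : I `<=` mhull I by move=> q Iq; exists I => //; split.
have S0 : S !=set0.
  by have [q Iq] := missing_neq0 mI; exists (angle p q), q => //; exact: IU.
have lS : has_lbound S by exists 0 => _ [q _ <-]; exact: angle_ge0.
have uS : has_ubound S.
  by exists (2 * pi) => _ [q _ <-]; exact: ltW (angle_lt2pi _ _).
have infS : has_inf S by []. have supS : has_sup S by [].
have Ust q : mhull I q -> s < angle p q < t.
  move=> [K [mK IK] Kq]; have [u [v [/andP[u0 uv] eK]]] := missing_arc mK.
  move: (Kq); rewrite eK => /(arc_angle _ uv)/andP[uq qv].
  have v2 := angle_lt2pi p v.
  have inS c : angle p u < c < angle p v -> s <= c <= t.
    move=> /andP[uc cv]; have [|a ea] := @angle_surj R p c; first by apply/andP; lra.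
    have Sc : S c.
      exists a => //; exists K => //; rewrite eK.
      by apply/(arc_angle _ uv); rewrite ea uc.
    by rewrite ge_inf // sup_ubound.
  (* The midpoints from [angle p q] towards both endpoint angles are attained in [K], which makes
     the weak bounds by [s] and [t] strict. *)
  have /andP[? ?] : s <= (angle p u + angle p q) / 2 <= t by apply: inS; apply/andP; lra.
  have /andP[? ?] : s <= (angle p v + angle p q) / 2 <= t by apply: inS; apply/andP; lra.
  by apply/andP; lra.
(* One member approaches each end up to [e]; being nested, the larger of the two approaches both. *)
have ex_K (e : R) : 0 < e -> exists K, [/\ missing K, I `<=` K &
    forall q, s + e <= angle p q <= t - e -> K q].
  move=> e0.
  have [_ [q1 [K1 [mK1 IK1] Kq1] <-] q1s] := inf_adherent e0 infS.
  have [_ [q2 [K2 [mK2 IK2] Kq2] <-] q2t] := sup_adherent e0 supS.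
  have [K [mK IK Kq1' Kq2']] : exists K, [/\ missing K, I `<=` K, K q1 & K q2].
    have [r Ir] := missing_neq0 mI.
    by have [h|h] := missing_nested mK1 mK2 (IK1 _ Ir) (IK2 _ Ir);
      [exists K2|exists K1]; split=> //; exact: h.
  exists K; split=> // q /andP[sq qt].
  have [u [v [/andP[u0 uv] eK]]] := missing_arc mK.
  move: Kq1' Kq2'; rewrite eK => /(arc_angle _ uv)/andP[? ?] /(arc_angle _ uv)/andP[? ?].
  have {}q1s : angle p q1 < s + e := q1s.
  have {}q2t : t - e < angle p q2 := q2t.
  by apply/(arc_angle _ uv)/andP; split; lra.
have ninv n : 0 < n.+1%:R^-1 :> R by rewrite invr_gt0.
have /choice[K KP] := fun n : nat => ex_K n.+1%:R^-1 (ninv n).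
have stK q : s < angle p q < t -> (\bigcup_n K n) q.
  move=> /andP[sq qt].
  have e0 : 0 < Num.min (angle p q - s) (t - angle p q).
    by rewrite lt_min; apply/andP; lra.
  have [n ne] : exists n : nat, n.+1%:R^-1 < Num.min (angle p q - s) (t - angle p q).
    by exists (Num.truncn (Num.min (angle p q - s) (t - angle p q))^-1);
      rewrite invf_plt ?posrE ?ltr0n // truncnS_gt.
  exists n => //; have [_ _] := KP n; apply.
  move: ne; move: (n.+1%:R^-1) => e; rewrite lt_min => /andP[? ?].
  by apply/andP; lra.
have KU : \bigcup_n K n = mhull I.
  apply/seteqP; split=> [q [n _ Knq]|q /Ust/stK //].
  by have [mK IK _] := KP n; exists (K n).
(* The [K n] need not increase. A finite union within a chain is one of its terms, so [K'] increases
   and still consists of members. *)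
pose K' n := \big[setU/set0]_(i < n.+1) K i.
have K'P n : missing (K' n) /\ I `<=` K' n.
  elim: n => [|n [mK' IK']].
    by rewrite /K' big_ord_recr big_ord0 /= set0U; have [] := KP 0.
  rewrite /K' big_ord_recr /= -/(K' n).
  have [mK IK _] := KP n.+1.
  have [r Ir] := missing_neq0 mI.
  have [/setUidPr ->|/setUidPl ->] // := missing_nested mK' mK (IK' _ Ir) (IK _ Ir).
have s0 : 0 <= s by apply: lb_le_inf => // _ [q _ <-]; exact: angle_ge0.
have t2 : t <= 2 * pi.
  by apply: ge_sup => // _ [q _ <-]; exact: ltW (angle_lt2pi _ _).
exists s, t; split=> //.
- by have [_ [q /Ust/andP[? ?] _]] := S0; lra.
- by move=> q; split; [exact: Ust|rewrite -KU; exact: stK].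
- exists K'; split; first by move=> n; have [] := K'P n.
    by move=> n; rewrite {2}/K' big_ord_recr /=; exact: subsetUl.
  by rewrite -KU -bigcup_bigsetU_bigcup.
Qed.

(* When the chain defining [mhull I] exhausts the circle minus [p], the duals of
   a cofinal sequence form a rainbow at [p]; otherwise its union is an arc. *)
Lemma mhull_missing I : missing I ->
  missing (mhull I) \/ exists I_ : nat -> set (S1 R), rainbow L p I_.
Proof.
move=> mI; have [s [t [s0 st t2 Ust [K [mK Ksub UK]]]]] := mhull_interval mI.
have pi0 := pi_gt0 R.
have nUp : ~ mhull I p by move/Ust; rewrite angle0 => /andP[? ?]; lra.
have hullL : nondegenerate_open_interval (mhull I) -> missing (mhull I).
  move=> nd; split=> //; rewrite UK; apply: (lam_closed lamL) => //.
    by move=> n; have [] := mK n.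
  by rewrite -UK.
have [u eu] : exists u, angle p u = s by apply: angle_surj; apply/andP; lra.
have [t2'|t2'] := ltP t (2 * pi).
  left; apply: hullL.
  have [w ew] : exists w, angle p w = t by apply: angle_surj; apply/andP; lra.
  exists u, w; split; first by move=> e; move: st; rewrite -eu -ew e ltxx.
  by apply/seteqP; split=> q; [move/Ust|move=> h; apply/Ust; move: h];
    rewrite -eu -ew -arc_angle // eu ew.
have {t2'} et : t = 2 * pi by apply/eqP; rewrite eq_le t2.
(* The upper end is now [p] itself: the union is [arc u p] if [s] is positive, and everything but
   [p] otherwise. *)
have [s_gt0|s_le0] := ltP 0 s.
  left; apply: hullL; exists u, p.
  split; first by move=> e; move: s_gt0; rewrite -eu e angle0 ltxx.
  apply/seteqP; split=> q.
    move=> /Ust/andP[sq _]; apply/(ccw_angleE p); constructor 3.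
    by rewrite angle0 eu sq s_gt0.
  move=> /(ccw_angleE p); rewrite angle0 eu => h; apply/Ust.
  by have := angle_lt2pi p q; have := angle_ge0 p q; case: h => /andP[? ?] ? ?;
    apply/andP; lra.
right; exists (fun n => dual (K n)).
have nd n : nondegenerate_open_interval (K n).
  by apply: (lam_interval lamL); have [] := mK n.
split=> [|n]; last exact: dual_missing.
split=> [n|n|].
- by apply: (lam_dual lamL); have [] := mK n.
- exact: arc_sub_dual.
apply/seteqP; split=> [q hq|_ -> n _]; last first.
  by apply: subset_closure; exact: dual_missing.
apply: contrapT => qp.
have : mhull I q by apply/Ust; rewrite et angle_lt2pi andbT (le_lt_trans s_le0) // angle_gt0.
rewrite UK => -[n _]; have [u' [v' [uv' eK]]] := nd n.
by have := hq n Logic.I; rewrite /= eK dual_arc // => /closure_arc.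
Qed.

Lemma rainbow_exists : very_full L -> exists I_ : nat -> set (S1 R), rainbow L p I_.
Proof.
move=> vf; apply: contrapT => norb.
have mh I : missing I -> missing (mhull I).
  by move=> mI; have [|] := mhull_missing mI.
have subh I : missing I -> I `<=` mhull I by move=> mI q Iq; exists I => //; split.
have gapP : gap L (mhull @` missing).
  split.
  - by move=> _ [I mI <-]; have [] := mh I mI.
  - move=> _ _ [I mI <-] [J mJ <-] neq; rewrite -subset0 => q [qI qJ].
    have incl A B : missing A -> missing B -> mhull A `<=` mhull B -> mhull A = mhull B.
      move=> mA mB AB; apply/seteqP; split=> // r Br; exists (mhull B) => //.
      by split; [exact: mh|exact: subset_trans (subh _ mA) AB].
    have [h|h] := missing_nested (mh _ mI) (mh _ mJ) qI qJ; apply: neq.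
      exact: incl.
    by symmetry; exact: incl.
  - move=> I LI; have [Ip|nIp] := pselect (I p).
      have mI := missing_dual LI Ip.
      by exists (mhull (dual I)); [exists (dual I)|right; exact: subh].
    have mI : missing I by [].
    by exists (mhull I); [exists I|left; exact: subh].
have pi0 := pi_gt0 R.
have finV := vf _ gapP.
have [e e0 eV] : exists2 e : R, 0 < e < 2 * pi &
    forall q, vertices (mhull @` missing) q -> angle p q = 0 \/ e <= angle p q.
  have [e e0 eV] := finite_set_gap (angle p) pi0 finV.
  exists e => [|q /eV]; first by move: e0 => /andP[? ?]; apply/andP; lra.
  have [->|qp] := pselect (q = p); first by rewrite angle0; left.
  by have := angle_gt0 qp; right; auto.
(* The point [y] is too close to [p] to be a vertex, so it lies in an element [M] of the gap, whose
   first endpoint [u] has angle strictly between [0] and [e]. *)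
have [y ey] : exists y, angle p y = e / 2.
  by apply: angle_surj; apply/andP; move: e0 => /andP[? ?]; lra.
have [M [I mI eM] My] : (\bigcup_(J in mhull @` missing) J) y.
  apply: contrapT => /eV; rewrite ey; move: e0 => /andP[? ?]; lra.
have [u [v [/andP[u0 uv] eMuv]]] : exists u v, 0 < angle p u < angle p v /\ M = arc u v.
  by rewrite -eM; exact/missing_arc/mh.
move: (My); rewrite eMuv => /(arc_angle _ uv); rewrite ey => /andP[uy yv].
(* No element of the gap contains [u]: it would differ from [M] and, being open, meet [M]. Thus [u]
   is a vertex, against the choice of [e]. *)
have /eV[] : vertices (mhull @` missing) u; [|move=> h|move=> h]; last 2 first.
- by move: u0; rewrite h ltxx.
- by move: e0 => /andP[? ?]; lra.
move=> [_ [J mJ <-] Ju].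
have ne : M <> mhull J.
  by move=> h; move: Ju; rewrite -h eMuv => /(arc_angle _ uv); rewrite ltxx.
have [_ dj _] := gapP.
have cu : closure M u.
  by rewrite eMuv; apply: (closure_arc_endpoints _).1 => h; rewrite h ltxx in uv.
have [q [Mq Jq]] : M `&` mhull J !=set0.
  apply: cu; apply: open_nbhs_nbhs; split=> //.
  by have [u' [v' [_ ->]]] := missing_arc (mh _ mJ); exact: open_arc.
have PM : (mhull @` missing) M by exists I.
have PJ : (mhull @` missing) (mhull J) by exists J.
by have [] : (set0 : set (S1 R)) q by rewrite -(dj _ _ PM PJ ne).
Qed.

End Rainbow.

(** * Extraction of sequences *)

Lemma increasing_seq_diag (Q : nat -> nat -> Prop) :
  (forall k N, exists2 n, (N <= n)%N & Q k n) ->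
  exists s : nat -> nat, increasing_seq s /\ forall k, Q k (s k).
Proof.
move=> exQ; have /choice[f fP] : forall kN : nat * nat, exists n, (kN.2 <= n)%N /\ Q kN.1 n.
  by move=> [k N]; have [n] := exQ k N; exists n.
pose s := fix s k := if k is k'.+1 then f (k, (s k').+1) else f (0, 0)%N.
exists s; split; first by apply/increasing_seqP => k; have [] := fP (k.+1, (s k).+1).
by case=> [|k]; [have [] := fP (0, 0)%N|have [] := fP (k.+1, (s k).+1)].
Qed.

Lemma increasing_seq_ge (s : nat -> nat) n : increasing_seq s -> (n <= s n)%N.
Proof.
move=> /increasing_seqP incs; elim: n => // n IHn.
exact: leq_ltn_trans IHn (incs n).
Qed.

Lemma increasing_seq_comp (s t : nat -> nat) :
  increasing_seq s -> increasing_seq t -> increasing_seq (s \o t).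
Proof. by move=> incs inct n m; exact: (etrans (incs _ _) (inct _ _)). Qed.

(** Each term is chosen with value below both the previous value and a reciprocal tending to [0]. *)
Lemma shrinking_seq (R : realType) (T : Type) (S : set T) (f : T -> R) :
  (forall x, S x -> 0 < f x) -> (forall e, 0 < e -> exists2 x, S x & f x < e) ->
  exists r : nat -> T, [/\ forall n, S (r n), forall n, f (r n.+1) <= f (r n) &
    forall e, 0 < e -> exists n, f (r n) < e].
Proof.
move=> f0 fS.
have /choice[F FP] : forall e, exists x, 0 < e -> S x /\ f x < e.
  (* Choice asks for a total function, so a nonpositive [e] receives an arbitrary point. *)
  move=> e; have [/fS[x]|e0] := ltP 0 e; first by exists x.
  by have [x _ _] := fS 1 ltr01; exists x.
pose r := fix r n := if n is n'.+1 then F (Num.min (f (r n')) n'.+1%:R^-1) else F 1.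
have rS n : S (r n).
  elim: n => [|n /f0 IHn] /=; first by have [] := FP 1 ltr01.
  by apply: (FP _ _).1; rewrite lt_min IHn invr_gt0 ltr0n.
have rlt n : f (r n.+1) < Num.min (f (r n)) n.+1%:R^-1.
  by apply: (FP _ _).2; rewrite lt_min f0 //= invr_gt0 ltr0n.
exists r; split=> // [n|e e0].
  by move: (rlt n); rewrite lt_min => /andP[/ltW].
exists (Num.truncn e^-1).+1; move: (rlt (Num.truncn e^-1)); rewrite lt_min => /andP[_].
by move=> /lt_trans; apply; rewrite invf_plt ?posrE ?ltr0n // truncnS_gt.
Qed.

(** * Leaves ending at the fixed point of a parabolic element *)

Section Approach.
Context {R : realType}.
Implicit Types (p q u v w a b : S1 R) (L : set (set (S1 R))) (h : homeoP R).

Lemma homeo_arc h u v : h @` arc u v = arc (h u) (h v).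
Proof.
apply/seteqP; split=> [_ [q uqv <-]|q]; first exact/homeo_ccw.
rewrite -(homeo_invK h q) => /homeo_ccw uqv.
by exists (homeo_inv h q); rewrite ?homeo_invK.
Qed.

(** Preserving [ccw p] amounts to preserving the order of positive angles; angle [0] is invisible to
    it, whence the separate case [h b = p]. *)
Lemma homeo_angle_le h p a b : h p = p ->
  angle p a <= angle p b -> angle p (h a) <= angle p (h b).
Proof.
move=> hp ab; rewrite leNgt; apply/negP => hba.
have [hbp|hbp] := pselect (h b = p).
  have bp : b = p by apply: (can_inj (homeo_funK h)); rewrite hbp hp.
  have ap : a = p.
    apply: contrapT => /angle_gt0; rewrite ltNge => /negP; apply.
    by rewrite (le_trans ab) // bp angle0.
  by rewrite ap hp hbp ltxx in hba.
have : ccw p (h b) (h a) by apply/ccw_base; rewrite angle_gt0.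
by rewrite -{1}hp => /homeo_ccw/ccw_base/andP[_]; rewrite ltNge ab.
Qed.

Section Cusp.
Context (L : set (set (S1 R))) (p : S1 R) (h : homeoP R).
Hypotheses (lamL : lamination_system L) (pE : endpoints L p) (hp : h p = p)
  (fixh : forall q, h q = q -> q = p) (hL : forall I, L I -> L (h @` I))
  (hVL : forall I, L I -> L ((h^-1)%g @` I)).

(** The far endpoints of the leaves that end at [p], a set preserved by [h] and its inverse. *)
Let S : set (S1 R) := [set r | r <> p /\ L (arc p r)].

Let hVp : (h^-1)%g p = p. Proof. by rewrite homeoVE -{1}hp homeo_funK. Qed.

Let S_neq0 : S !=set0.
Proof.
have [I LI Ip] := pE; have [u [v [uv eI]]] := lam_interval lamL LI.
have dI : L (arc v u) by rewrite -(dual_arc uv) -eI; exact: lam_dual.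
have [up|up] := pselect (u = p).
  by exists v; split; rewrite -up -?eI //; exact: not_eq_sym.
have [vp|vp] := pselect (v = p); first by exists u; split=> //; rewrite -vp.
exfalso; apply: Ip; have [c|c] := ccw_total up (not_eq_sym vp) uv.
  by exists I; [left|rewrite eI].
exists (dual I); first by right.
by rewrite eI dual_arc //; exact: ccw_cycle.
Qed.

Let S_h r : S r -> S (h r).
Proof.
move=> [rp Lr]; split; last by rewrite -hp -homeo_arc; exact: hL.
by move=> e; apply: rp; apply: (can_inj (homeo_funK h)); rewrite e hp.
Qed.

Let S_hV r : S r -> S ((h^-1)%g r).
Proof.
move=> [rp Lr]; split; last by rewrite -hVp -homeo_arc; exact: hVL.
by move=> e; apply: rp; apply: (can_inj (homeo_funK (h^-1)%g)); rewrite e hVp.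
Qed.

Let hVK q : h ((h^-1)%g q) = q. Proof. exact: homeo_invK. Qed.
Let hK q : (h^-1)%g (h q) = q. Proof. exact: homeo_funK. Qed.

(* The infimum of an invariant set of angles would be a second fixed point. *)
Let S_inf e : 0 < e -> exists2 r, S r & angle p r < e.
Proof.
move=> e0; apply: contrapT => ne.
have lS : forall r, S r -> e <= angle p r.
  by move=> r Sr; rewrite leNgt; apply/negP => re; apply: ne; exists r.
pose A := angle p @` S.
have A0 : A !=set0 by have [r Sr] := S_neq0; exists (angle p r), r.
have lA : has_lbound A by exists e => _ [r /lS ? <-].
have ec : e <= inf A by apply: lb_le_inf => // _ [r /lS ? <-].
have cle r : S r -> inf A <= angle p r by move=> Sr; apply: ge_inf => //; exists r.
have [w ew] : exists w, angle p w = inf A.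
  apply: angle_surj; have [r Sr] := S_neq0.
  by rewrite (le_trans (ltW e0)) //= (le_lt_trans (cle _ Sr)) // angle_lt2pi.
have wp : w <> p by move=> wp; move: ec; rewrite -ew wp angle0 leNgt e0.
apply: wp; apply: fixh; apply: (@angle_inj _ p); apply/eqP; rewrite eq_le; apply/andP; split.
  rewrite [leRHS]ew; apply: lb_le_inf => // _ [r Sr <-].
  by rewrite -[r in leRHS]hVK homeo_angle_le // ew cle //; exact: S_hV.
rewrite -[w in leLHS]hVK homeo_angle_le // [leRHS]ew; apply: lb_le_inf => // _ [r Sr <-].
by rewrite -[r in leRHS]hK homeo_angle_le // ew cle //; exact: S_h.
Qed.

(** Both [h] and its inverse send the point [w] realizing the supremum to an angle at least as
    large, so [w] is fixed; yet it differs from [p], the supremum being positive. *)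
Let S_sup e : 0 < e -> exists2 r, S r & 2 * pi - angle p r < e.
Proof.
move=> e0; apply: contrapT => ne.
have lS : forall r, S r -> angle p r <= 2 * pi - e.
  move=> r Sr; rewrite leNgt; apply/negP => re; apply: ne; exists r => //; lra.
pose A := angle p @` S.
have A0 : A !=set0 by have [r Sr] := S_neq0; exists (angle p r), r.
have uA : has_ubound A by exists (2 * pi - e) => _ [r /lS ? <-].
have ec : sup A <= 2 * pi - e by apply: ge_sup => // _ [r /lS ? <-].
have cle r : S r -> angle p r <= sup A by move=> Sr; apply: sup_ubound => //; exists r.
have c0 : 0 < sup A.
  by have [r Sr] := S_neq0; apply: lt_le_trans (cle _ Sr); apply: angle_gt0; case: Sr.
have [w ew] : exists w, angle p w = sup A.
  by apply: angle_surj; apply/andP; lra.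
have wp : w <> p by move=> wp; move: c0; rewrite -ew wp angle0 ltxx.
apply: wp; apply: fixh; apply: (@angle_inj _ p); apply/eqP; rewrite eq_le; apply/andP; split.
  rewrite -[w in leRHS]hVK homeo_angle_le // [leLHS]ew; apply: ge_sup => // _ [r Sr <-].
  by rewrite -[r in leLHS]hK homeo_angle_le // ew cle //; exact: S_h.
rewrite [leLHS]ew; apply: ge_sup => // _ [r Sr <-].
by rewrite -[r in leLHS]hVK homeo_angle_le // ew cle //; exact: S_hV.
Qed.

Lemma cusp_right : exists r_ : nat -> S1 R,
  (forall n, r_ n <> p) /\ quasi_rainbow L p (fun n => arc p (r_ n)).
Proof.
have [|r [rS rdec r0]] := shrinking_seq _ S_inf; first by move=> q [/angle_gt0].
exists r; split; first by move=> n; have [] := rS n.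
split=> [n|n q|]; first by have [] := rS n.
  by move=> /ccw_base/andP[q0 qr]; apply/ccw_base; rewrite q0 (lt_le_trans qr).
apply/seteqP; split=> [q hq|_ -> n _]; last first.
  by apply: (closure_arc_endpoints _).1; apply/not_eq_sym; have [] := rS n.
apply: contrapT => /angle_gt0/r0[n rq].
apply: (closure_arc (hq n Logic.I)); apply: ccw_cycle; apply/ccw_base.
by rewrite rq andbT; apply: angle_gt0; have [] := rS n.
Qed.

(** Angles near [2 * pi] approach [p] from the other side; the arcs are duals of those defining
    [S]. *)
Lemma cusp_left : exists l_ : nat -> S1 R,
  (forall n, l_ n <> p) /\ quasi_rainbow L p (fun n => arc (l_ n) p).
Proof.
have [|r [rS rdec r0]] := shrinking_seq _ S_sup.
  by move=> q _; rewrite subr_gt0 angle_lt2pi.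
have rp n : r n <> p by have [] := rS n.
exists r; split=> //; split=> [n|n q|].
- by rewrite -(dual_arc (not_eq_sym (rp n))); apply: lam_dual => //; have [] := rS n.
- move=> /ccw_cycle/ccw_cycle/ccw_base/andP[_ rq]; apply: ccw_cycle; apply/ccw_base.
  rewrite angle_gt0 //= (le_lt_trans _ rq) //.
  by have := rdec n; lra.
apply/seteqP; split=> [q hq|_ -> n _]; last first.
  by apply: (closure_arc_endpoints _).2; apply/not_eq_sym.
apply: contrapT => qp; have := angle_lt2pi p q; rewrite -subr_gt0 => /r0[n rq].
apply: (closure_arc (hq n Logic.I)); apply/ccw_base.
by rewrite angle_gt0 //=; lra.
Qed.

End Cusp.

End Approach.

(** Terms equal to [p] are discarded because the one-sided arcs at a cusp omit [p]. *)
Definition clusters {R : realType} (y : nat -> S1 R) (p : S1 R) : Prop :=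
  forall a b, ccw a p b -> forall N, exists n,
    [/\ (N <= n)%N, ccw a (y n) b & y n <> p].

(** * Capture of a clustering sequence *)

Section Main.
Context {R : realType} {G : set (homeoP R)} {L_ : 'I_2 -> set (set (S1 R))}.
Hypotheses (sG : subgroup G) (hL : pants_like G L_).

Lemma quasi_rainbow_clusters y p : clusters y p ->
  exists s : nat -> nat, increasing_seq s /\
    exists (i : 'I_2) (I_ : nat -> set (S1 R)),
      quasi_rainbow (L_ i) p I_ /\ forall k, I_ k (y (s k)).
Proof.
move=> yp; have [lam _ cusp] := hL.
suff [i [I_ [qI freq]]] : exists (i : 'I_2) (I_ : nat -> set (S1 R)),
    quasi_rainbow (L_ i) p I_ /\ forall k N, exists2 n, (N <= n)%N & I_ k (y n).
  have [s [incs sI]] := @increasing_seq_diag (fun k n => I_ k (y n)) freq.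
  by exists s; split=> //; exists i, I_.
have [[i pi]|allE] := pselect (exists i, ~ endpoints (L_ i) p).
  have [lami _ vfi] := lam i.
  have [I_ [qI Ip]] := rainbow_exists lami pi vfi.
  exists i, I_; split=> // k N; have [LI _ _] := qI.
  have [u [v [_ eI]]] := lam_interval lami (LI k).
  have : ccw u p v by have := Ip k; rewrite eI.
  by move=> /yp/(_ N)[n [Nn un _]]; exists n; rewrite ?eI.
have {}allE i : endpoints (L_ i) p by apply: contrapT => h; apply: allE; exists i.
have [h [Gh [_ [c fixh]] hp]] : cusp_point G p.
  by apply: (cusp ord0 ord_max).
have [lam0 inv _] := lam ord0.
have cp : c = p by apply/esym/fixh.
have fixp q : h q = q -> q = p by move=> /fixh ->.
have GhV : G (h^-1)%g by have [G1 GM] := sG; have := GM _ _ G1 Gh; rewrite mul1g.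
have [r [rp qr]] := cusp_right lam0 (allE _) hp fixp
  (fun I => inv _ _ Gh) (fun I => inv _ _ GhV).
have [l [lp ql]] := cusp_left lam0 (allE _) hp fixp
  (fun I => inv _ _ Gh) (fun I => inv _ _ GhV).
(* Terms near [p] lie on one of its two sides, so if some right arc is eventually avoided, every
   left arc is visited infinitely often. *)
have [right_freq|] := pselect (forall k N, exists2 n, (N <= n)%N & arc p (r k) (y n)).
  by exists ord0, (fun n => arc p (r n)).
move=> /existsNP[k0 /existsNP[N0 nright]].
exists ord0, (fun n => arc (l n) p); split=> // k N.
(* With [b] at angle [t / 2], [arc (l k) b] surrounds [p], and its part beyond [p] lies in the
   avoided arc. *)
pose t := Num.min (angle p (r k0)) (angle p (l k)).
have t0 : 0 < t by rewrite lt_min !angle_gt0.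
have tr : t <= angle p (r k0) by rewrite ge_min lexx.
have tl : t <= angle p (l k) by rewrite ge_min lexx orbT.
have l2 := angle_lt2pi p (l k).
have [b eb] : exists b, angle p b = t / 2 by apply: angle_surj; apply/andP; lra.
have lpb : ccw (l k) p b.
  by do 2 apply: ccw_cycle; apply/ccw_base; rewrite eb; apply/andP; lra.
have [n [Nn lyb yp']] := yp _ _ lpb (maxn N N0).
exists n; first by rewrite (leq_trans _ Nn) // leq_maxl.
have y0 := angle_gt0 yp'.
have nr : ~ arc p (r k0) (y n).
  by move=> h'; apply: nright; exists n => //; rewrite (leq_trans _ Nn) // leq_maxr.
have {}nr : ~ (angle p (y n) < angle p (r k0)).
  by move=> h'; apply: nr; apply/ccw_base; rewrite y0.
apply: ccw_cycle; apply/ccw_base; move: lyb => /(ccw_angleE p); rewrite eb => h'.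
by apply/andP; case: h' => /andP[? ?]; lra.
Qed.

End Main.

(** * Subsequences, convergence and trapped arcs *)

Lemma quasi_rainbow_sub (R : realType) (L : set (set (S1 R))) p
    (I_ : nat -> set (S1 R)) s :
  quasi_rainbow L p I_ -> increasing_seq s -> quasi_rainbow L p (I_ \o s).
Proof.
move=> [LI Idec Ip] incs.
have Ile m n : (m <= n)%N -> I_ n `<=` I_ m.
  elim: n => [|n IHn]; first by rewrite leqn0 => /eqP ->.
  by rewrite leq_eqVlt => /orP[/eqP -> //|/IHn]; exact: subset_trans.
split=> [n|n|]; [exact: LI|by apply: Ile; move/increasing_seqP: incs => /(_ n)/ltnW|].
rewrite -Ip; apply/seteqP; split=> q hq n _; last exact: hq.
by apply: closureS (hq n Logic.I); apply: Ile; exact: increasing_seq_ge.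
Qed.

Lemma cvg_ccw (R : realType) (x_ : nat -> S1 R) x a b :
  x_ n @[n --> \oo] --> x -> ccw a x b ->
  exists N, forall n, (N <= n)%N -> ccw a (x_ n) b.
Proof.
move=> xx axb; have [N _ hN] := xx _ (open_nbhs_nbhs (conj (open_arc a b) axb)).
by exists N.
Qed.

(** Choose [a'] between [a] and [p], and [b'] between [p] and [b]. The closed arc from [a'] to [b']
    is what [ccw_trap] controls. *)
Lemma ccw_shrink (R : realType) (a p b : S1 R) : ccw a p b ->
  exists a' b', ccw a' p b' /\ forall w, ~ ccw b' w a' -> ccw a w b.
Proof.
move=> apb; have [ap pb _] := ccw_irr apb.
have [a' aa'p] := ccw_dense ap; have [b' pb'b] := ccw_dense pb.
exists a', b'.
move: apb aa'p pb'b => /(ccw_angleE a) h1 /(ccw_angleE a) h2 /(ccw_angleE a) h3.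
rewrite angle0 in h1 h2.
have b0 := angle_ge0 a b; have p0 := angle_ge0 a p.
have a'0 := angle_ge0 a a'; have b'0 := angle_ge0 a b'.
have {}h1 : 0 < angle a p < angle a b by case: h1 => /andP[? ?]; apply/andP; lra.
have {}h2 : 0 < angle a a' < angle a p by case: h2 => /andP[? ?]; apply/andP; lra.
move: h1 h2 => /andP[? ?] /andP[? ?].
have {}h3 : angle a p < angle a b' < angle a b by case: h3 => /andP[? ?]; apply/andP; lra.
move: h3 => /andP[? ?].
split; first by apply/(ccw_angleE a); constructor; apply/andP; lra.
move=> w nw; apply/ccw_base.
have w0 := angle_ge0 a w.
have [wa'|a'w] := ltP (angle a w) (angle a a').
  by case: nw; apply/(ccw_angleE a); constructor 2; apply/andP; lra.
have [b'w|wb'] := ltP (angle a b') (angle a w).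
  by case: nw; apply/(ccw_angleE a); constructor 3; apply/andP; lra.
by apply/andP; lra.
Qed.

(* [a] and [b] lie outside the arc, so the arc, which meets [arc a b], stays
   inside it. *)
Lemma ccw_trap (R : realType) (u v a b z w : S1 R) :
  ccw a z b -> ccw u z v -> ~ ccw u a v -> ~ ccw u b v -> ~ ccw v w u ->
  ~ ccw b w a.
Proof.
move=> /(ccw_angleE u) azb /ccw_base/andP[z0 zv] na nb nw /(ccw_angleE u) bwa.
have a0 := angle_ge0 u a; have b0 := angle_ge0 u b; have w0 := angle_ge0 u w.
have {}na : angle u a = 0 \/ angle u v <= angle u a.
  have [|h] := leP (angle u v) (angle u a); first by right.
  left; apply/eqP; rewrite eq_le a0 andbT leNgt; apply/negP => h'.
  by apply: na; apply/ccw_base; rewrite h'.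
have {}nb : angle u b = 0 \/ angle u v <= angle u b.
  have [|h] := leP (angle u v) (angle u b); first by right.
  left; apply/eqP; rewrite eq_le b0 andbT leNgt; apply/negP => h'.
  by apply: nb; apply/ccw_base; rewrite h'.
have {}nw : angle u w <= angle u v.
  rewrite leNgt; apply/negP => h; apply: nw; apply: ccw_cycle.
  by apply/ccw_base; rewrite h (lt_trans z0 zv).
case: azb => /andP[? ?]; case: bwa => /andP[? ?]; case: na => ?; case: nb => ?; lra.
Qed.

Theorem lemma4p9 (R : realType) (G : set (homeoP R))
    (L_ : 'I_2 -> set (set (S1 R)))
    (x_ : nat -> S1 R) (x : S1 R) (g_ : nat -> homeoP R) (x' : S1 R)
    (hG : pants_like_COL 2 G) (hL : pants_like G L_)
    (hx : x_ n @[n --> \oo] --> x)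
    (hgG : forall n, G (g_ n)) (hg : injective g_)
    (hx' : g_ n (x_ n) @[n --> \oo] --> x') :
  [\/ exists s : nat -> nat, increasing_seq s /\
        forall k, g_ (s k) x = x',
      exists s : nat -> nat, increasing_seq s /\
        exists (i : 'I_2) (I_ : nat -> set (S1 R)),
          quasi_rainbow (L_ i) x' I_ /\
          pre_approximation G (L_ i) x' (fun k => g_ (s k)) I_
    | exists s : nat -> nat, increasing_seq s /\
        exists (i : 'I_2) (I_ : nat -> set (S1 R)),
          quasi_rainbow (L_ i) x I_ /\
          pre_approximation G (L_ i) x (fun k => ((g_ (s k))^-1)%g) I_].
Proof.
have [sG _] := hG.
have GV n : G ((g_ n)^-1)%g.
  by have [G1 GM] := sG; have := GM _ _ G1 (hgG n); rewrite mul1g.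
have [freq1|] := pselect (forall N, exists2 n, (N <= n)%N & g_ n x = x').
  by constructor 1; exact: (@increasing_seq_diag (fun _ n => g_ n x = x') (fun _ => freq1)).
move=> /existsNP[N0 ne1].
have {}ne1 n : (N0 <= n)%N -> (g_ n)^-1%g x' <> x.
  by move=> Nn e; apply: ne1; exists n => //; rewrite -e homeoVE homeo_invK.
(* Clustering at [x] leads to (3), with [x'] as the common point whose images are captured; the
   other alternative is (2). *)
suff [cl|] : clusters (fun n => (g_ n)^-1%g x') x \/
    exists s : nat -> nat, increasing_seq s /\
      exists (i : 'I_2) (I_ : nat -> set (S1 R)) z,
        quasi_rainbow (L_ i) x' I_ /\ forall k, I_ k (g_ (s k) z).
- constructor 3; have [s [incs [i [I_ [qI Iy]]]]] := quasi_rainbow_clusters sG hL cl.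
  by exists s; split=> //; exists i, I_; split=> //; split=> //; exists x'.
- move=> [s [incs [i [I_ [z [qI Iz]]]]]]; constructor 2.
  by exists s; split=> //; exists i, I_; split=> //; split=> //; exists z.
(* Capture at [x'] needs terms different from [x']. If [x'] recurs, [g_n^-1(x') = x_n] along a
   subsequence, which already tends to [x]. *)
have [freq|] := pselect (forall N, exists2 n, (N <= n)%N & g_ n (x_ n) = x').
  left=> a b axb N; have [N1 hN1] := cvg_ccw hx axb.
  have [n Nn e] := freq (maxn N (maxn N0 N1)).
  move: Nn; rewrite !geq_max => /and3P[Nn N0n N1n].
  exists n; split; [by []| |exact: ne1].
  by rewrite -e homeoVE homeo_funK; exact: hN1.
move=> /existsNP[N1 ne2].
have [|s [incs [i [I_ [qI Iy]]]]] :=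
    @quasi_rainbow_clusters _ _ _ sG hL (fun n => g_ n (x_ n)) x'.
  move=> a b ax'b N; have [N2 hN2] := cvg_ccw hx' ax'b.
  exists (maxn N (maxn N1 N2)); split; first exact: leq_maxl.
    by apply: hN2; rewrite !leq_max leqnn !orbT.
  by move=> e; apply: ne2; eexists; last exact: e; rewrite !leq_max leqnn !orbT.
have [[z zfreq]|nz] := pselect
    (exists z, forall N, exists2 k, (N <= k)%N & I_ k (g_ (s k) z)).
  right; have [t [inct It]] :=
    @increasing_seq_diag (fun _ k => I_ k (g_ (s k) z)) (fun _ => zfreq).
  exists (s \o t); split; first exact: increasing_seq_comp.
  by exists i, (I_ \o t), z; split=> //; exact: quasi_rainbow_sub.
(* Every point eventually leaves the pulled back arcs; this is used for [a'] and [b']. *)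
have {nz} evI z : exists N, forall k, (N <= k)%N -> ~ I_ k (g_ (s k) z).
  apply: contrapT => h; apply: nz; exists z => N; apply: contrapT => h'.
  by apply: h; exists N => k Nk Ik; apply: h'; exists k.
left=> a b /ccw_shrink[a' [b' [a'xb' sub]]] N.
have [N2 hN2] := cvg_ccw hx a'xb'.
have [Na hNa] := evI a'; have [Nb hNb] := evI b'.
pose k := maxn (maxn N N0) (maxn N2 (maxn Na Nb)).
have /and5P[kN kN0 kN2 kNa kNb] : [&& N <= k, N0 <= k, N2 <= k, Na <= k & Nb <= k]%N.
  by rewrite /k !leq_max !leqnn !orbT.
have sk := increasing_seq_ge k incs.
exists (s k); split; [exact: leq_trans sk| |by apply: ne1; exact: leq_trans sk].
have [LI _ cI] := qI; have [lam _ _] := hL; have [lami _ _] := lam i.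
have [u [v [_ eI]]] := lam_interval lami (LI k).
(* Only the closure of [I_ k] is known to contain [x'], so its preimage is located in a closed
   arc. *)
have x'I : ~ ccw v x' u.
  apply: closure_arc; rewrite -eI.
  by have /(_ k Logic.I) : (\bigcap_n closure (I_ n)) x' by rewrite cI.
pose f := homeo_inv (g_ (s k)).
have fE w z y : ccw (f w) (f z) (f y) <-> ccw w z y.
  by rewrite -(homeo_ccw (g_ (s k))) !homeo_invK.
have gE z : ccw (f u) z (f v) <-> I_ k (g_ (s k) z).
  by rewrite eI /= -{1}(homeo_funK (g_ (s k)) z); exact: fE.
(* The pulled back arc contains [x_ (s k)], which is between [a'] and [b'], and omits both of these
   points. *)
apply: sub; apply: (@ccw_trap _ (f u) (f v) _ _ (x_ (s k))).
- by apply: hN2; exact: leq_trans sk.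
- by apply/gE.
- by move=> /gE; exact: hNa.
- by move=> /gE; exact: hNb.
- by move=> /fE.
Qed.
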